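(* Let $(X_{\alpha},\delta_{\alpha})_{\alpha\in I}$ be a collection of proximity spaces and for each $\alpha$ let $i_{\alpha}:X_{\alpha}\to\coprod_{\alpha}X_{\alpha}$ be the canonical set injection. Then $(\coprod_{\alpha}X_{\alpha},\delta)$ is the coproduct in the category of proximity spaces, i.e., if $(Y,\delta_Y)$ is a proximity space and for each $\alpha$ we have a proximity map $f_{\alpha}:X_{\alpha}\to Y$, then there exists a unique proximity map $h:\coprod_{\alpha}X_{\alpha}\to Y$ such that $h\circ i_{\alpha}=f_{\alpha}$ for every $\alpha$.
   Context: A proximity on a set $X$ is a binary relation $\delta$ on the power set of $X$ such that for all $A,B,C\subseteq X$: (1) $A\delta B\Rightarrow B\delta A$; (2) $A\delta B\Rightarrow A,B\neq\emptyset$; (3) $A\cap B\neq\emptyset\Rightarrow A\delta B$; (4) $A\delta(B\cup C)\iff A\delta B$ or $A\delta C$; (5) if not $A\delta B$, then there is $E\subseteq X$ with not $A\delta E$ and not $(X\setminus E)\delta B$. A pair $(X,\delta)$ is then a proximity space. A map $f:(X,\delta_X)\to(Y,\delta_Y)$ is a proximity map if $A\delta_X B$ implies $f(A)\delta_Y f(B)$. The category of proximity spaces has proximity spaces as objects and proximity maps as morphisms. $I$ is an arbitrary index set; $\coprod_\alpha X_\alpha$ is the disjoint union of sets and $\delta$ is the proximity on it defined by $A\delta B\iff A_\alpha\delta_\alpha B_\alpha$ for some $\alpha$, where $A_\alpha:=A\cap X_\alpha$. *)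

(* Defs.v *)
From mathcomp Require Import all_boot.
From mathcomp Require Import classical_sets.

Set Implicit Arguments.
Unset Strict Implicit.
Unset Printing Implicit Defensive.

Local Open Scope classical_set_scope.

Record is_proximity (X : Type) (delta : set X -> set X -> Prop) : Prop :=
  IsProximity {
    prox_sym : forall A B, delta A B -> delta B A;
    prox_nonempty : forall A B, delta A B -> A <> set0 /\ B <> set0;
    prox_meet : forall A B, A `&` B <> set0 -> delta A B;
    prox_setU : forall A B C, delta A (B `|` C) <-> delta A B \/ delta A C;
    prox_separation : forall A B, ~ delta A B ->
      exists E : set X, ~ delta A E /\ ~ delta (~` E) B
  }.

Definition proximity_map (X Y : Type) (deltaX : set X -> set X -> Prop)
    (deltaY : set Y -> set Y -> Prop) (f : X -> Y) : Prop :=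
  forall A B, deltaX A B -> deltaY (f @` A) (f @` B).

(* The disjoint union is the sigma type {a : I & X a}, with [existT X a] as the
   canonical injection of X a; the trace of A on X a is then a preimage. *)
Definition coproduct_proximity (I : Type) (X : I -> Type)
    (delta : forall a, set (X a) -> set (X a) -> Prop)
    (A B : set {a : I & X a}) : Prop :=
  exists a, delta a (existT X a @^-1` A) (existT X a @^-1` B).

(* Main.v *)
Require Import Defs.
From mathcomp Require Import all_boot.
From mathcomp Require Import boolp classical_sets.

(** Every axiom of a proximity is checked on the disjoint union one summand at
    a time, because taking the trace on a summand is a preimage and commutes
    with unions, intersections and complements.  The only axiom whose witness
    is not inherited from a single summand is separation: two sets that are far
    in the union are far in all summands at once, so a separating set has to be
    chosen in each summand, and the union of these choices has them as traces.

    As for maps, a set map out of the disjoint union is the same as a family of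
    set maps out of the summands, which gives the only possible [h] and its
    uniqueness.  That the injections and [h] preserve nearness follows from
    monotonicity of proximities ([proximity_subset]): [A] is contained in the
    trace of its image under an injection, and the image under [f a] of a trace
    of [A] is contained in the image of [A] under [h]. *)

Local Open Scope classical_set_scope.

(** A set containing [A] is its own union with [A], so the union axiom in each
    argument gives monotonicity. *)
Lemma proximity_subset {X : Type} {delta : set X -> set X -> Prop}
    {A A' B B' : set X} :
  is_proximity delta -> A `<=` A' -> B `<=` B' -> delta A B -> delta A' B'.
Proof.
move=> delta_prox sAA' sBB' dAB.
have monor C D D' : D `<=` D' -> delta C D -> delta C D'.
  move=> sDD' dCD; rewrite -(setUidr sDD').
  by apply/(prox_setU delta_prox); left.
apply: (monor _ _ _ sBB').
by apply/(prox_sym delta_prox)/(monor _ _ _ sAA')/(prox_sym delta_prox).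
Qed.

Section Coproduct.
Context {I : Type} {X : I -> Type}.
Context {delta : forall a : I, set (X a) -> set (X a) -> Prop}.
Hypothesis delta_prox : forall a : I, is_proximity (delta a).

Lemma coproduct_is_proximity : is_proximity (coproduct_proximity delta).
Proof.
split.
- by move=> A B [a dAB]; exists a; apply: prox_sym (delta_prox a) _ _ dAB.
- move=> A B [a /(prox_nonempty (delta_prox a))[A0 B0]].
  by split=> S0; [apply: A0 | apply: B0]; rewrite S0 preimage_set0.
- move=> A B /eqP/set0P[[a x] ABx]; exists a.
  by apply: (prox_meet (delta_prox a)); apply/eqP/set0P; exists x.
- move=> A B C; split.
    by move=> [a /(prox_setU (delta_prox a))[]]; [left | right]; exists a.
  by case=> -[a dA]; exists a; apply/(prox_setU (delta_prox a)); [left | right].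
- move=> A B farAB.
  have sep a : exists E : set (X a),
      ~ delta a (existT X a @^-1` A) E /\ ~ delta a (~` E) (existT X a @^-1` B).
    by apply: (prox_separation (delta_prox a)) => dAB; apply: farAB; exists a.
  pose E a := sval (cid (sep a)).
  exists [set p | E (projT1 p) (projT2 p)].
  by split=> -[a]; have [farAE farEB] := svalP (cid (sep a)).
Qed.

Lemma proximity_map_injection (a : I) :
  proximity_map (delta a) (coproduct_proximity delta) (existT X a).
Proof.
move=> A B dAB; exists a.
by apply: (proximity_subset (delta_prox a) _ _ dAB); apply: preimage_image.
Qed.

End Coproduct.

Definition copairing {I : Type} {X : I -> Type} {Y : Type}
    (f : forall a : I, X a -> Y) (p : {a : I & X a}) : Y :=
  f (projT1 p) (projT2 p).

Lemma proximity_map_copairing {I : Type} {X : I -> Type} {Y : Type}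
    {delta : forall a : I, set (X a) -> set (X a) -> Prop}
    {deltaY : set Y -> set Y -> Prop} {f : forall a : I, X a -> Y} :
  is_proximity deltaY -> (forall a : I, proximity_map (delta a) deltaY (f a)) ->
  proximity_map (coproduct_proximity delta) deltaY (copairing f).
Proof.
move=> deltaY_prox f_prox A B [a /f_prox dfAB].
by apply: (proximity_subset deltaY_prox _ _ dfAB) => _ [x Sx <-];
  exists (existT X a x).
Qed.

Theorem proposition3p7 (I : Type) (X : I -> Type)
    (delta : forall a : I, set (X a) -> set (X a) -> Prop)
    (delta_prox : forall a : I, is_proximity (delta a)) :
  is_proximity (coproduct_proximity delta) /\
  (forall a : I,
     proximity_map (delta a) (coproduct_proximity delta) (existT X a)) /\
  (forall (Y : Type) (deltaY : set Y -> set Y -> Prop),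
     is_proximity deltaY ->
     forall f : forall a : I, X a -> Y,
     (forall a : I, proximity_map (delta a) deltaY (f a)) ->
     exists! h : {a : I & X a} -> Y,
       proximity_map (coproduct_proximity delta) deltaY h /\
       (forall a : I, h \o existT X a = f a)).
Proof.
split; first exact: coproduct_is_proximity.
split; first exact: proximity_map_injection.
move=> Y deltaY deltaY_prox f f_prox; exists (copairing f); split.
  by split=> //; apply: proximity_map_copairing.
by move=> h [_ hf]; apply/funext => -[a x]; rewrite /copairing /= -hf.
Qed.
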